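(* Let $a,b,c,d,q,n$ be the quantities given in the context. The function \[ U(w)=\frac{8 a \{ q(1-2w) + (n-1)w^2 \} + 16\, bc\, (1-w)^2}{\left[ d\{ q + (n-1-2q)w \} + c(1-w) \right]^2},\qquad 0\le w\le 1, \] attains its unique minimum over $[0,1]$ at \[ w^* = \frac{adq+2bcd}{2adq+2bcd+ac}. \]
   Context: Let $n,p,q$ be positive integers with $p\ge 2$ and $n>1+q$. Let $\boldsymbol{X}$ be a real $n\times q$ matrix with $\mathrm{rank}(\boldsymbol{X})=q$ and $\boldsymbol{X}'\boldsymbol{1}_n=\boldsymbol{0}_q$ ($'$ is transpose, $\boldsymbol{1}_n$ the all-ones vector), $\boldsymbol{\alpha}\in\mathbb{R}^q$, and let $\boldsymbol{\Sigma}$ be a $p\times p$ positive-definite matrix with eigenvalues $\lambda_1>\lambda_2\ge\cdots\ge\lambda_p>0$. Put \[ a = \mathrm{tr}(\boldsymbol{\Sigma}^2) + (\mathrm{tr}(\boldsymbol{\Sigma}))^2,\quad b = \lambda_1 + \mathrm{tr}(\boldsymbol{\Sigma}),\quad c = \| \boldsymbol{X}\boldsymbol{\alpha} \|^2,\quad d = \lambda_1-\lambda_2 , \] where $\|\cdot\|$ is the Euclidean norm. *)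

(* Defs.v *)
From mathcomp Require Import all_boot all_order all_algebra.

Set Implicit Arguments.
Unset Strict Implicit.
Unset Printing Implicit Defensive.

Import Order.TTheory GRing.Theory Num.Theory.
Local Open Scope ring_scope.

Definition enorm (R : rcfType) (n : nat) (v : 'cV[R]_n) : R :=
  Num.sqrt (\sum_i v i 0 ^+ 2).

Definition posdefmx (R : rcfType) (p : nat) (S : 'M[R]_p) : Prop :=
  S \is symmetricmx /\
  forall v : 'cV[R]_p, v != 0 -> 0 < (v^T *m S *m v) 0 0.

(* [lam] lists the eigenvalues of [S] in decreasing order, each repeated
   according to its algebraic multiplicity.  Indices start at 0: the
   mathematical lambda_i is [lam`_(i - 1)]. *)
Definition ordered_eigenvalues (R : rcfType) (p : nat) (S : 'M[R]_p)
    (lam : p.-tuple R) : Prop :=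
  char_poly S = \prod_(x <- lam) ('X - x%:P) /\ sorted >=%R lam.

Definition minimizer_on (R : rcfType) (D : interval R) (f : R -> R) (x : R) :
    Prop :=
  x \in D /\ forall y : R, y \in D -> f x <= f y.

Definition objU (R : rcfType) (n q : nat) (a b c d w : R) : R :=
  (8 * a * (q%:R * (1 - 2 * w) + (n%:R - 1) * w ^+ 2)
     + 16 * b * c * (1 - w) ^+ 2)
  / (d * (q%:R + (n%:R - 1 - 2 * q%:R) * w) + c * (1 - w)) ^+ 2.

Definition wstar (R : rcfType) (q : nat) (a b c d : R) : R :=
  (a * d * q%:R + 2 * b * c * d)
  / (2 * a * d * q%:R + 2 * b * c * d + a * c).

(* Main.v *)
Require Import Defs.
From mathcomp Require Import all_boot all_order all_algebra.
From mathcomp Require Import ring lra.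
Import Order.TTheory GRing.Theory Num.Theory.
Local Open Scope ring_scope.

(** With m = n - 1 - q, [U(w)] is a ratio
    (A (1 - w)^2 + B w^2) / (E (1 - w) + F w)^2 with A = 8aq + 16bc, B = 8am,
    E = dq + c, F = dm all positive.  By the Cauchy-Schwarz inequality it is at
    least AB / (E^2 B + F^2 A), with equality iff F A (1 - w) = E B w. *)

Lemma unique_minimizer_quadratic_ratio (R : rcfType) (A B E F : R) (f : R -> R) :
  0 < A -> 0 < B -> 0 < E -> 0 < F ->
  (forall w, f w = (A * (1 - w) ^+ 2 + B * w ^+ 2)
                   / (E * (1 - w) + F * w) ^+ 2) ->
  unique (minimizer_on `[0, 1] f) (F * A / (F * A + E * B)).
Proof.
move=> A0 B0 E0 F0 fE; set w0 := _ / _.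
have FA0 : 0 < F * A by rewrite mulr_gt0.
have EB0 : 0 < E * B by rewrite mulr_gt0.
have S0 : 0 < F * A + E * B by rewrite addr_gt0.
pose K := E ^+ 2 * B + F ^+ 2 * A.
have K0 : 0 < K by rewrite addr_gt0 // mulr_gt0 // exprn_gt0.
(* Lagrange's form of the Cauchy-Schwarz defect, with [x = 1 - w], [y = w]: [(A x^2 + B y^2) K - A B
   (E x + F y)^2 = (F A x - E B y)^2]. *)
have gap w : w \in `[0, 1] -> f w - A * B / K =
    (F * A * (1 - w) - E * B * w) ^+ 2 / (K * (E * (1 - w) + F * w) ^+ 2)
    /\ 0 < E * (1 - w) + F * w.
  rewrite in_itv /= => /andP[w_ge0 w_le1].
  have D0 : 0 < E * (1 - w) + F * w.
    (* At [w = 1] only the term in [F] survives; elsewhere the term in [E] is already strictly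
       positive. *)
    have [-> | w_neq1] := eqVneq w 1.
      by rewrite subrr mulr0 add0r mulr1.
    apply: ltr_wpDr; first by rewrite mulr_ge0 // ltW.
    by rewrite mulr_gt0 // subr_gt0 lt_neqAle w_neq1.
  split=> //; rewrite fE /K; field.
  by rewrite -/K !gt_eqF.
have w0_in : w0 \in `[0, 1].
  rewrite in_itv /=; apply/andP; split; first by rewrite divr_ge0 // ltW.
  by rewrite ler_pdivrMr // mul1r lerDl ltW.
have fw0 : f w0 = A * B / K.
  apply/eqP; rewrite -subr_eq0 (gap w0 w0_in).1.
  have -> : F * A * (1 - w0) - E * B * w0 = 0.
    by rewrite /w0; field; rewrite gt_eqF.
  by rewrite expr0n mul0r.
split.
  split=> // y y_in; rewrite fw0 -subr_ge0; have [-> D0] := gap y y_in.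
  by rewrite divr_ge0 ?sqr_ge0 // mulr_ge0 ?sqr_ge0 // ltW.
move=> y [y_in /(_ w0 w0_in)].
rewrite fw0 -subr_le0; have [-> D0] := gap y y_in.
rewrite pmulr_lle0 ?invr_gt0 ?mulr_gt0 ?exprn_gt0 // => sq_le0.
have : (F * A * (1 - y) - E * B * y) ^+ 2 == 0.
  by rewrite eq_le sq_le0 sqr_ge0.
rewrite sqrf_eq0 => /eqP y_eq.
(* The vanishing form is affine in [y] with slope [- (F * A + E * B)] and root [w0], so the added
   quotient is identically [w0 - y]. *)
have -> : y = y + (F * A * (1 - y) - E * B * y) / (F * A + E * B).
  by rewrite y_eq mul0r addr0.
by rewrite /w0; field; rewrite gt_eqF.
Qed.

(** Diagonal entries are the values of the quadratic form at the standard basis vectors. *)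
Lemma posdefmx_trace_gt0 (R : rcfType) (p : nat) (S : 'M[R]_p) :
  (0 < p)%N -> posdefmx S -> 0 < \tr S.
Proof.
move=> p0 [_ S_pos].
have diag_gt0 i : 0 < S i i.
  have := S_pos (delta_mx i 0); rewrite trmx_delta -rowE -colE !mxE; apply.
  apply/eqP => /matrixP/(_ i 0); rewrite !mxE !eqxx /= => /eqP.
  by rewrite oner_eq0.
rewrite /mxtrace (bigD1 (Ordinal p0)) //= ltr_wpDr //.
by apply: sumr_ge0 => i _; apply: ltW.
Qed.

(** By symmetry this trace is the sum of the squares of all entries, the squared Frobenius norm. *)
Lemma symmetricmx_trace_sqr_ge0 (R : realFieldType) (p : nat) (S : 'M[R]_p) :
  S \is symmetricmx -> 0 <= \tr (S ^+ 2).
Proof.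
rewrite is_hermitianmxE expr0 scale1r => /eqP S_sym.
apply: sumr_ge0 => i _; rewrite expr2 mxE; apply: sumr_ge0 => j _.
by rewrite [in X in _ * X]S_sym !mxE -expr2 sqr_ge0.
Qed.

Theorem theorem3p4 (R : rcfType) (n p q : nat)
    (hn : (0 < n)%N) (hp : (2 <= p)%N) (hq : (0 < q)%N) (hnq : (1 + q < n)%N)
    (X : 'M[R]_(n, q)) (hrank : \rank X = q)
    (hX1 : X^T *m (const_mx 1 : 'cV[R]_n) = 0)
    (alpha : 'cV[R]_q)
    (Sigma : 'M[R]_p) (hSigma : posdefmx Sigma)
    (lam : p.-tuple R) (hlam : ordered_eigenvalues Sigma lam)
    (hlam12 : lam`_1 < lam`_0) (hlamp : 0 < lam`_(p.-1)) :
  let a := \tr (Sigma ^+ 2) + (\tr Sigma) ^+ 2 in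
  let b := lam`_0 + \tr Sigma in
  let c := enorm (X *m alpha) ^+ 2 in
  let d := lam`_0 - lam`_1 in
  unique (minimizer_on `[0, 1] (objU n q a b c d)) (wstar q a b c d).
Proof.
move=> a b c d.
have p0 : (0 < p)%N := ltnW hp.
have tr0 : 0 < \tr Sigma by apply: posdefmx_trace_gt0.
have a0 : 0 < a.
  rewrite ltr_wpDl ?exprn_gt0 //.
  by apply: symmetricmx_trace_sqr_ge0; case: hSigma.
have b0 : 0 < b.
  rewrite addr_gt0 //; apply: lt_le_trans hlamp _.
  (* The largest eigenvalue dominates the smallest, which sits at index [p.-1]. *)
  apply: (sorted_leq_nth ge_trans ge_refl 0 (proj2 hlam)) => //;
    by rewrite inE size_tuple ?prednK.
(* Only weak, since [alpha] may be zero; strictness of [A] and [E] comes from [a * q%:R] and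
   [d * q%:R]. *)
have c0 : 0 <= c by rewrite sqr_ge0.
have d0 : 0 < d by rewrite subr_gt0.
have q0 : 0 < q%:R :> R by rewrite ltr0n.
pose m : R := n%:R - 1 - q%:R.
have m0 : 0 < m by rewrite /m -addrA -opprD nat1r subr_gt0 ltr_nat.
have aq0 : 0 < a * q%:R by rewrite mulr_gt0.
have bc0 : 0 <= b * c by rewrite mulr_ge0 // ltW.
have dq0 : 0 < d * q%:R by rewrite mulr_gt0.
clearbody a b c d.
pose A := 8 * (a * q%:R) + 16 * (b * c); pose B := 8 * (a * m).
pose E := d * q%:R + c; pose F := d * m.
have A0 : 0 < A by rewrite /A; lra.
have B0 : 0 < B by rewrite !mulr_gt0.
have E0 : 0 < E by rewrite /E; lra.
have F0 : 0 < F by rewrite mulr_gt0.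
(* The two fractions differ by the common factor [8 * m]. *)
have -> : wstar q a b c d = F * A / (F * A + E * B).
  have den0 : 0 < 2 * a * d * q%:R + 2 * b * c * d + a * c.
    have := mulr_gt0 aq0 d0; have := mulr_ge0 bc0 (ltW d0).
    by have := mulr_ge0 (ltW a0) c0; lra.
  have den'0 : 0 < F * A + E * B by rewrite addr_gt0 // mulr_gt0.
  apply/eqP; rewrite /wstar eqr_div ?lt0r_neq0 //.
  by apply/eqP; rewrite /A /B /E /F; ring.
apply: unique_minimizer_quadratic_ratio => // w.
(* This rests on [q (1 - 2w) + (n - 1) w^2 = q (1 - w)^2 + m w^2] and
   [q + (n - 1 - 2q) w = q (1 - w) + m w]. *)
by rewrite /objU /A /B /E /F /m; congr (_ / _ ^+ 2); ring.
Qed.
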